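(* Put $p\geq 3$, $\lambda=\lambda_p=2\cos(\pi/p)$ and $U=ST$. Suppose that $\alpha$ is a hyperbolic fixed point of $G_p$, with Hecke conjugate $\alpha'$. Then $\alpha$ is $G_p$-reduced and its $\lambda$-continued fraction has exactly $k$ leading ones if and only if $k$ is the smallest nonnegative integer such that $$0<\alpha'<U^{k+2}(0)<\alpha<U^{k+1}(0).$$
   Context: Let $S=\begin{pmatrix}1&\lambda\\0&1\end{pmatrix}$, $T=\begin{pmatrix}0&-1\\1&0\end{pmatrix}$, and $G_p=\langle S,T\rangle/\{\pm I\}$ acting on $\mathbb{R}\cup\{\infty\}$ by linear fractional transformations. A hyperbolic element has $|{\rm trace}|>2$ and two distinct real fixed points; a hyperbolic fixed point is a fixed point of a hyperbolic element of $G_p$, and its Hecke conjugate is the other fixed point of the elements of its stabilizer. The $\lambda$-continued fraction of a real $\alpha$: $\alpha_0=\alpha$, $r_j=\lfloor\alpha_j/\lambda\rfloor+1$, $\alpha_{j+1}=\frac{1}{r_j\lambda-\alpha_j}$, giving $\alpha=r_0\lambda-\cfrac{1}{r_1\lambda-\cfrac{1}{r_2\lambda-\cdots}}=[r_0;r_1,\dots]$. It has exactly $k$ leading ones if $r_0=\cdots=r_{k-1}=1$ and $r_k\neq1$. A real $\alpha$ is $G_p$-reduced if its $\lambda$-continued fraction is purely periodic ($r_{j+m}=r_j$ for all $j\ge0$, some $m\ge1$) with period other than $(2,1,\dots,1)$ with $p-3$ ones. *)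

(* Defs.v *)
From Stdlib Require Import Reals Lra Lia ZArith.
Open Scope R_scope.

Definition lam (p : nat) : R := 2 * cos (PI / INR p).

Record mat := Mat { ma : R; mb : R; mc : R; md : R }.

Definition mmul (M N : mat) : mat :=
  Mat (ma M * ma N + mb M * mc N) (ma M * mb N + mb M * md N)
      (mc M * ma N + md M * mc N) (mc M * mb N + md M * md N).

Definition mid : mat := Mat 1 0 0 1.

(* adjugate; equals the inverse for determinant-one matrices *)
Definition madj (M : mat) : mat := Mat (md M) (- mb M) (- mc M) (ma M).

Fixpoint mpow (M : mat) (n : nat) : mat :=
  match n with O => mid | S n' => mmul M (mpow M n') end.

Definition Smat (l : R) : mat := Mat 1 l 0 1.
Definition Tmat : mat := Mat 0 (-1) 1 0.
Definition Umat (l : R) : mat := mmul (Smat l) Tmat.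

(* The matrix group <S,T> in SL(2,R).  G_p is its image modulo {+-I};
   since M and -M act identically and have the same |trace|, all notions
   below are insensitive to the quotient. *)
Inductive in_Gp (l : R) : mat -> Prop :=
| Gp_S : in_Gp l (Smat l)
| Gp_T : in_Gp l Tmat
| Gp_mul : forall M N, in_Gp l M -> in_Gp l N -> in_Gp l (mmul M N)
| Gp_inv : forall M, in_Gp l M -> in_Gp l (madj M).

(* R u {infinity}: None = infinity *)
Definition ext := option R.

Definition act (M : mat) (x : ext) : ext :=
  match x with
  | Some t => if Req_EM_T (mc M * t + md M) 0 then None
              else Some ((ma M * t + mb M) / (mc M * t + md M))
  | None => if Req_EM_T (mc M) 0 then None else Some (ma M / mc M)
  end.

(* strict order on R u {infinity}, with infinity treated as +infinity *)
Definition ext_lt (x y : ext) : Prop :=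
  match x, y with
  | Some a, Some b => a < b
  | Some _, None => True
  | None, _ => False
  end.

Definition hyperbolic (M : mat) : Prop := Rabs (ma M + md M) > 2.

Definition fixes (M : mat) (x : R) : Prop := act M (Some x) = Some x.

Definition hyperbolic_fixed_point (l : R) (alpha : R) : Prop :=
  exists M, in_Gp l M /\ hyperbolic M /\ fixes M alpha.

Definition hecke_conjugate (l : R) (alpha alpha' : R) : Prop :=
  alpha' <> alpha /\
  exists M, in_Gp l M /\ hyperbolic M /\ fixes M alpha /\ fixes M alpha'.

Definition Rfloor (x : R) : Z := (up x - 1)%Z.

Definition cf_digit (l x : R) : Z := (Rfloor (x / l) + 1)%Z.

Fixpoint cf_alpha (l alpha : R) (j : nat) : R :=
  match j with
  | O => alpha
  | S j' => let a := cf_alpha l alpha j' in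
            / (IZR (cf_digit l a) * l - a)
  end.

Definition cf_r (l alpha : R) (j : nat) : Z := cf_digit l (cf_alpha l alpha j).

Definition purely_periodic (r : nat -> Z) : Prop :=
  exists m : nat, (1 <= m)%nat /\ forall j, r (j + m)%nat = r j.

Definition exceptional_period (p : nat) (r : nat -> Z) : Prop :=
  forall j, r j = (if Nat.eqb (j mod (p - 2)) 0 then 2%Z else 1%Z).

Definition Gp_reduced (p : nat) (alpha : R) : Prop :=
  purely_periodic (cf_r (lam p) alpha) /\
  ~ exceptional_period p (cf_r (lam p) alpha).

Definition leading_ones (l alpha : R) (k : nat) : Prop :=
  (forall j, (j < k)%nat -> cf_r l alpha j = 1%Z) /\ cf_r l alpha k <> 1%Z.

Definition chain (l alpha alpha' : R) (k : nat) : Prop :=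
  0 < alpha' /\
  ext_lt (Some alpha') (act (mpow (Umat l) (k + 2)) (Some 0)) /\
  ext_lt (act (mpow (Umat l) (k + 2)) (Some 0)) (Some alpha) /\
  ext_lt (Some alpha) (act (mpow (Umat l) (k + 1)) (Some 0)).

(* Main.v *)
Require Import Defs.
From Stdlib Require Import Reals Lra Lia ZArith List Classical.
Open Scope R_scope.

(* Up to sign, every element of the group is [T^e W T^f] with [W] a product of the matrices
   [- U^(j+1) T], [j < p - 1], which have nonnegative entries and diagonal entries at least 1.
   Hence a hyperbolic element never fixes [0] or [infinity], so no point [U^n (0)] is a
   hyperbolic fixed point, and an element with fixed points of opposite signs is such a
   product [W] up to sign and inversion.

   Expand [alpha] and apply the same Moebius maps to [alpha'].  The region
   [0 < alpha' < U^(k+2)(0) < alpha < U^(k+1)(0)], [k <= p - 3], is mapped into itself, and two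
   pairs of the region that differ by a translation coincide, so the step is injective there.
   If [0 < alpha' < lambda < alpha], then [alpha - lambda] and [alpha' - lambda] have opposite
   signs and are fixed by some [W]; reading off the factors of [W] shows that the pair returns
   to itself.  This gives pure periodicity in the region.  Conversely every pair of conjugate
   fixed points enters the region, because otherwise pulling back vectors along the expansion
   gives [n |alpha - alpha'| <= 1] for all [n]; periodic digits then bring the pair back to its
   start.  The exceptional period is the expansion of the cusp [lambda]. *)

Section Hecke.

Context (p : nat) (Hp : (3 <= p)%nat).

Local Notation l := (lam p).

(** * The ratios [sin (n PI / p) / sin (PI / p)] *)

(* [U^n (0) = s n / s (n - 1)]; every comparison with [U^n (0)] is stated
   cross-multiplied, so that [U (0) = infinity] needs no special case. *)
Definition s (n : nat) : R := sin (INR n * (PI / INR p)) / sin (PI / INR p).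

Lemma INR_p_ge : 3 <= INR p.
Proof. apply (le_INR 3) in Hp. simpl in Hp. lra. Qed.

Lemma angle_pos : 0 < PI / INR p.
Proof. pose proof INR_p_ge. pose proof PI_RGT_0. apply Rdiv_lt_0_compat; lra. Qed.

Lemma angle_mul : INR p * (PI / INR p) = PI.
Proof. pose proof INR_p_ge. field. lra. Qed.

Lemma sin_angle_pos (n : nat) :
  (0 < n < p)%nat -> 0 < sin (INR n * (PI / INR p)).
Proof.
  intros [H0 H1]. pose proof angle_pos. pose proof angle_mul.
  apply lt_INR in H0. apply lt_INR in H1. simpl in H0.
  apply sin_gt_0; nra.
Qed.

Lemma sin_unit_pos : 0 < sin (PI / INR p).
Proof.
  pose proof (sin_angle_pos 1 ltac:(lia)) as H. simpl in H.
  now rewrite Rmult_1_l in H.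
Qed.

Lemma s_0 : s 0 = 0.
Proof. unfold s. simpl. rewrite Rmult_0_l, sin_0. unfold Rdiv. ring. Qed.

Lemma s_1 : s 1 = 1.
Proof.
  pose proof sin_unit_pos. unfold s. simpl. rewrite Rmult_1_l. field. lra.
Qed.

Lemma s_p : s p = 0.
Proof. unfold s. rewrite angle_mul, sin_PI. unfold Rdiv. ring. Qed.

Lemma s_rec (n : nat) : s (S (S n)) = l * s (S n) - s n.
Proof.
  pose proof sin_unit_pos. unfold s, lam.
  set (t := PI / INR p) in *.
  replace (INR (S (S n)) * t) with (INR (S n) * t + t) by (rewrite (S_INR (S n)); ring).
  replace (INR n * t) with (INR (S n) * t - t) by (rewrite S_INR; ring).
  rewrite sin_plus, sin_minus. field. lra.
Qed.

Lemma s_2 : s 2 = l.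
Proof. rewrite s_rec, s_1, s_0. ring. Qed.

Lemma s_pos (n : nat) : (0 < n < p)%nat -> 0 < s n.
Proof.
  intros H. apply Rdiv_lt_0_compat; [ now apply sin_angle_pos | apply sin_unit_pos ].
Qed.

Lemma s_nonneg (n : nat) : (n <= p)%nat -> 0 <= s n.
Proof.
  intros H. destruct (Nat.eq_dec n 0) as [->|]; [ rewrite s_0; lra | ].
  destruct (Nat.eq_dec n p) as [->|]; [ rewrite s_p; lra | ].
  left. apply s_pos. lia.
Qed.

(** This is the determinant of [U^(n+1)]. It gives [1 <= s n] for [0 < n < p], and it inverts the
    changes of coordinates used further on. *)
Lemma s_cassini (n : nat) : s (S n) * s (S n) - s n * s (S (S n)) = 1.
Proof.
  induction n as [|n IH]; [ rewrite s_2, s_1, s_0; ring | ].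
  rewrite (s_rec (S n)). rewrite (s_rec n) in *. lra.
Qed.

Lemma s_ge1 (n : nat) : (0 < n < p)%nat -> 1 <= s n.
Proof.
  intros H. destruct n as [|n]; [ lia | ].
  pose proof (s_cassini n). pose proof (s_pos (S n) ltac:(lia)).
  pose proof (s_nonneg n ltac:(lia)). pose proof (s_nonneg (S (S n)) ltac:(lia)).
  assert (0 <= s n * s (S (S n))) by (apply Rmult_le_pos; lra). nra.
Qed.

Lemma lam_ge1 : 1 <= l.
Proof. rewrite <- s_2. apply s_ge1. lia. Qed.

Lemma s_pred_p (n : nat) : p = S n -> s n = 1.
Proof.
  intros E. destruct n as [|n]; [ lia | ].
  pose proof (s_cassini n) as H. pose proof (s_ge1 (S n) ltac:(lia)).
  rewrite <- E, s_p in H. nra.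
Qed.

Lemma s_pred2_p (n : nat) : p = S (S n) -> s n = l.
Proof.
  intros E. pose proof (s_rec n) as H. rewrite <- E, s_p in H.
  rewrite (s_pred_p (S n) E) in H. lra.
Qed.

Lemma s_succ_p : s (S p) = -1.
Proof.
  destruct p as [|n] eqn:E; [ lia | ].
  rewrite <- E in *. rewrite E at 1. rewrite s_rec, <- E, s_p, (s_pred_p n E). ring.
Qed.

(** * Digits and the simultaneous expansion of a pair *)

Lemma digit_unique (x : R) (r : Z) :
  (IZR r - 1) * l <= x < IZR r * l -> cf_digit l x = r.
Proof.
  intros [H1 H2]. pose proof lam_ge1.
  unfold cf_digit, Rfloor. ring_simplify (up (x / l) - 1 + 1)%Z. symmetry.
  assert (E : x / l * l = x) by (field; lra).
  apply tech_up; nra.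
Qed.

Lemma digit_bounds (x : R) :
  (IZR (cf_digit l x) - 1) * l <= x < IZR (cf_digit l x) * l.
Proof.
  pose proof lam_ge1. unfold cf_digit, Rfloor.
  ring_simplify (up (x / l) - 1 + 1)%Z. destruct (archimed (x / l)).
  assert (E : x / l * l = x) by (field; lra). nra.
Qed.

Lemma digit_add (x : R) (n : nat) :
  IZR (cf_digit l (x + INR n * l)) = IZR (cf_digit l x) + INR n.
Proof.
  rewrite INR_IZR_INZ, <- plus_IZR. f_equal. apply digit_unique.
  rewrite plus_IZR. pose proof (digit_bounds x). nra.
Qed.

Lemma digit_ge2 (x : R) : l <= x -> 2 <= IZR (cf_digit l x).
Proof.
  intros H. pose proof lam_ge1. destruct (digit_bounds x) as [_ H2].
  apply IZR_le. apply Z.lt_pred_le. apply lt_IZR. simpl. nra.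
Qed.

Lemma digit_one (x : R) : 0 <= x < l -> cf_digit l x = 1%Z.
Proof. intros H. apply digit_unique. lra. Qed.

(** The digit is read off the first component only; the conjugate is carried along by the same
    Moebius map. *)
Definition pstep (q : R * R) : R * R :=
  let r := IZR (cf_digit l (fst q)) in (/ (r * l - fst q), / (r * l - snd q)).

Definition piter (n : nat) (q : R * R) : R * R := Nat.iter n pstep q.

Lemma piter_S (n : nat) (q : R * R) : piter (S n) q = piter n (pstep q).
Proof. apply Nat.iter_succ_r. Qed.

Lemma piter_Sout (n : nat) (q : R * R) : piter (S n) q = pstep (piter n q).
Proof. reflexivity. Qed.

Lemma piter_add (n m : nat) (q : R * R) : piter (n + m) q = piter n (piter m q).
Proof. apply Nat.iter_add. Qed.

Lemma piter_mul (n m : nat) (q : R * R) : piter n q = q -> piter (m * n) q = q.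
Proof.
  intros H. induction m as [|m IH]; [ reflexivity | ].
  simpl. rewrite piter_add, IH. exact H.
Qed.

Lemma piter_fst (n : nat) (a b : R) : fst (piter n (a, b)) = cf_alpha l a n.
Proof.
  induction n as [|n IH]; [ reflexivity | ].
  rewrite piter_Sout. simpl. now rewrite IH.
Qed.

Lemma pstep_add (a b : R) (n : nat) :
  pstep (a + INR n * l, b + INR n * l) = pstep (a, b).
Proof.
  unfold pstep. simpl. rewrite digit_add. f_equal; f_equal; ring.
Qed.

(** The denominator lies in [(0, l]], so after any step the first component is at least
    [1 / l = U^(p-1)(0)]. *)
Lemma pstep_fst_ge (q : R * R) : 1 <= fst (pstep q) * l.
Proof.
  pose proof lam_ge1. pose proof (digit_bounds (fst q)).
  unfold pstep. simpl. set (t := IZR _ * l - fst q).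
  assert (0 < t <= l) by (unfold t; lra).
  apply Rmult_le_reg_l with t; [ lra | ].
  rewrite <- Rmult_assoc, Rinv_r; lra.
Qed.

(** * Leading ones *)

(** The interval [[U^(k+2)(0), U^(k+1)(0))]; as [s 0 = 0], cell 0 is [[l, infinity)]. *)
Definition cell (k : nat) (a : R) : Prop :=
  (k + 1 < p)%nat /\ s (k + 2) <= a * s (k + 1) /\ a * s k < s (k + 1).

Lemma cell_0 (a : R) : cell 0 a <-> l <= a.
Proof.
  unfold cell. simpl. rewrite s_2, s_1, s_0.
  split; intros; [ lra | repeat split; [ lia | lra | lra ] ].
Qed.

Lemma cell_pos (k : nat) (a : R) : cell k a -> 0 <= a.
Proof.
  intros (Hk & H1 & _). pose proof (s_pos (k + 1) ltac:(lia)).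
  pose proof (s_nonneg (k + 2) ltac:(lia)). nra.
Qed.

Lemma below_lam (k : nat) (a : R) : (k < p - 1)%nat -> a * s (S k) < s (S k + 1) -> a < l.
Proof.
  replace (S k + 1)%nat with (S (S k)) by lia. rewrite s_rec. intros Hk H.
  pose proof (s_pos (S k) ltac:(lia)). pose proof (s_nonneg k ltac:(lia)). nra.
Qed.

Lemma cell_S_digit (k : nat) (a : R) : cell (S k) a -> cf_digit l a = 1%Z.
Proof.
  intros H. apply digit_one. split; [ eapply cell_pos; eauto | ].
  destruct H as (Hk & _ & H). apply (below_lam k); [ lia | assumption ].
Qed.

Lemma pstep_one (a b : R) :
  cf_digit l a = 1%Z -> pstep (a, b) = (/ (l - a), / (l - b)).
Proof. intros H. unfold pstep. simpl. rewrite H. f_equal; f_equal; ring. Qed.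

(* [U^-1] shifts the intervals cut out by the points [U^n (0)]. *)
Lemma shift_lt (k : nat) (a : R) :
  a < l -> a * s (S k) < s (S (S k)) -> / (l - a) * s k < s (S k).
Proof.
  intros H H1. rewrite s_rec in H1.
  apply Rmult_lt_reg_l with (l - a); [ lra | ].
  rewrite <- Rmult_assoc, Rinv_r; lra.
Qed.

Lemma shift_gt (k : nat) (a : R) :
  a < l -> s (S (S k)) < a * s (S k) -> s (S k) < / (l - a) * s k.
Proof.
  intros H H1. rewrite s_rec in H1.
  apply Rmult_lt_reg_l with (l - a); [ lra | ].
  rewrite <- Rmult_assoc, Rinv_r; lra.
Qed.

Lemma shift_ge (k : nat) (a : R) :
  a < l -> s (S (S k)) <= a * s (S k) -> s (S k) <= / (l - a) * s k.
Proof.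
  intros H H1. rewrite s_rec in H1.
  apply Rmult_le_reg_l with (l - a); [ lra | ].
  rewrite <- Rmult_assoc, Rinv_r; lra.
Qed.

Lemma cell_S_step (k : nat) (a : R) : cell (S k) a -> cell k (/ (l - a)).
Proof.
  intros (Hk & H1 & H2). pose proof (below_lam k a ltac:(lia) H2) as H3.
  replace (S k + 1)%nat with (S (S k)) in * by lia.
  replace (S k + 2)%nat with (S (S (S k))) in * by lia.
  unfold cell. replace (k + 2)%nat with (S (S k)) by lia.
  replace (k + 1)%nat with (S k) in * by lia.
  split; [ lia | split; [ now apply shift_ge | now apply shift_lt ] ].
Qed.

(** A digit 1 acts as [U^-1] and moves cell [k + 1] to cell [k]; in cell 0 the digit is at least
    2. *)
Lemma cell_leading_ones (k : nat) (a : R) : cell k a -> leading_ones l a k.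
Proof.
  revert a. induction k as [|k IH]; intros a H.
  - split; [ lia | ]. apply cell_0 in H. apply digit_ge2 in H.
    unfold cf_r. simpl. intros E. rewrite E in H. lra.
  - pose proof (cell_S_digit k a H) as E.
    assert (Hs : forall j, cf_r l a (S j) = cf_r l (/ (l - a)) j).
    { intros j. unfold cf_r. rewrite <- (piter_fst (S j) a 0), piter_S, pstep_one by assumption.
      now rewrite piter_fst. }
    destruct (IH _ (cell_S_step k a H)) as [H1 H2]. split.
    + intros [|j] Hj; [ exact E | ]. rewrite Hs. apply H1. lia.
    + now rewrite Hs.
Qed.

Lemma leading_ones_unique (a : R) (j k : nat) :
  leading_ones l a j -> leading_ones l a k -> j = k.
Proof.
  intros [H1 H2] [H3 H4]. destruct (Nat.lt_trichotomy j k) as [H|[H|H]]; auto.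
  - now specialize (H3 _ H).
  - now specialize (H1 _ H).
Qed.

Lemma cell_exists_le (n : nat) (a : R) :
  (n + 1 < p)%nat -> s (n + 2) <= a * s (n + 1) -> exists k, (k <= n)%nat /\ cell k a.
Proof.
  induction n as [|n IH]; intros Hn H.
  - exists O. split; [ lia | ]. apply cell_0. simpl in H. rewrite s_2, s_1 in H. lra.
  - destruct (Rle_lt_dec (s (n + 2)) (a * s (n + 1))) as [H1|H1].
    + destruct IH as (k & Hk & HI); [ lia | assumption | ]. exists k. split; [ lia | assumption ].
    + exists (S n). split; [ lia | ]. replace (n + 2)%nat with (S n + 1)%nat in H1 by lia.
      replace (n + 1)%nat with (S n) in H1 by lia. unfold cell. auto.
Qed.

Lemma cell_exists_strong (a : R) : 1 <= a * l -> exists k, (k + 3 <= p)%nat /\ cell k a.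
Proof.
  intros H. destruct (cell_exists_le (p - 3) a) as (k & Hk & HI);
    [ lia | | exists k; split; [ lia | assumption ] ].
  (* [s (p-1) = 1] and [s (p-2) = l], so the lower end of cell [p - 3] is [1 / l]. *)
  rewrite (s_pred_p (p - 3 + 2)) by lia. rewrite (s_pred2_p (p - 3 + 1)) by lia. exact H.
Qed.

(** The closed form of [U^-(k+1)] on both components: [b] obeys the same upper bound as [a], so no
    denominator vanishes during the run of ones. *)
Lemma piter_cell (k : nat) (a b : R) :
  cell (S k) a -> b * s (S k) < s (S (S k)) ->
  piter (S k) (a, b) =
    ((s (S k) - s k * a) / (s (S (S k)) - s (S k) * a),
     (s (S k) - s k * b) / (s (S (S k)) - s (S k) * b)).
Proof.
  revert a b. induction k as [|k IH]; intros a b Ha Hb.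
  - rewrite piter_S, pstep_one by now apply (cell_S_digit 0).
    unfold piter. simpl. rewrite s_2, s_1, s_0. f_equal; unfold Rdiv.
    + replace (l - 1 * a) with (l - a) by ring. ring.
    + replace (l - 1 * b) with (l - b) by ring. ring.
  - rewrite piter_S, pstep_one by now apply (cell_S_digit (S k)).
    pose proof (cell_S_step (S k) a Ha) as HI.
    destruct Ha as (Hk & _ & Ha).
    replace (S (S k) + 1)%nat with (S (S (S k))) in * by lia.
    assert (Hl : forall c, c * s (S (S k)) < s (S (S (S k))) -> c < l).
    { intros c Hc. apply (below_lam (S k)); [ lia | ].
      now replace (S (S k) + 1)%nat with (S (S (S k))) by lia. }
    rewrite IH by (try assumption; apply shift_lt; auto).
    assert (Hf : forall c, c * s (S (S k)) < s (S (S (S k))) ->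
      (s (S k) - s k * / (l - c)) / (s (S (S k)) - s (S k) * / (l - c)) =
      (s (S (S k)) - s (S k) * c) / (s (S (S (S k))) - s (S (S k)) * c)).
    { intros c Hc. pose proof (Hl c Hc) as Hcl.
      pose proof (shift_lt (S k) c Hcl Hc) as Hd.
      replace (s (S (S k)) - s (S k) * c) with (s (S k) * (l - c) - s k)
        by (rewrite (s_rec k); ring).
      replace (s (S (S (S k))) - s (S (S k)) * c) with (s (S (S k)) * (l - c) - s (S k)) in *
        by (rewrite (s_rec (S k)); ring).
      field. rewrite (s_rec (S k)) in Hc. repeat split; lra. }
    now rewrite !Hf.
Qed.


(** * Normal form of the elements of the group *)

Definition mneg (M : mat) : mat := Mat (- ma M) (- mb M) (- mc M) (- md M).

Definition det (M : mat) : R := ma M * md M - mb M * mc M.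

Ltac mat_ring :=
  repeat match goal with M : mat |- _ => destruct M end;
  unfold mneg, det, Umat, Smat, Tmat, mid, madj, mmul; simpl;
  match goal with
  | |- Mat _ _ _ _ = _ => f_equal; ring
  | _ => ring
  end.

Lemma mmul_assoc (M N Q : mat) : mmul M (mmul N Q) = mmul (mmul M N) Q.
Proof. mat_ring. Qed.

Lemma mmul_id_l (M : mat) : mmul mid M = M.
Proof. mat_ring. Qed.

Lemma mneg_mneg (M : mat) : mneg (mneg M) = M.
Proof. mat_ring. Qed.

Lemma mmul_neg_r (M N : mat) : mmul M (mneg N) = mneg (mmul M N).
Proof. mat_ring. Qed.

Lemma mmul_neg_l (M N : mat) : mmul (mneg M) N = mneg (mmul M N).
Proof. mat_ring. Qed.

Lemma madj_mmul (M N : mat) : madj (mmul M N) = mmul (madj N) (madj M).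
Proof. mat_ring. Qed.

Lemma det_mmul (M N : mat) : det (mmul M N) = det M * det N.
Proof. mat_ring. Qed.

Lemma in_Gp_det (M : mat) : in_Gp l M -> det M = 1.
Proof.
  induction 1; [ mat_ring | mat_ring | rewrite det_mmul; nra | ].
  rewrite <- IHin_Gp. mat_ring.
Qed.

(* [Wm j = - U^(j+1) T] maps the positive half-line onto the interior of [cell j]. *)
Definition Wm (j : nat) : mat := Mat (s (j + 1)) (s (j + 2)) (s j) (s (j + 1)).

Definition wprod (w : list nat) : mat := fold_right (fun j M => mmul (Wm j) M) mid w.

Definition letters (w : list nat) : Prop := Forall (fun j => (j + 1 < p)%nat) w.

Definition nonneg_mat (M : mat) : Prop :=
  1 <= ma M /\ 0 <= mb M /\ 0 <= mc M /\ 1 <= md M /\ det M = 1.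

Lemma Wm_nonneg (j : nat) : (j + 1 < p)%nat -> nonneg_mat (Wm j).
Proof.
  intros H. unfold nonneg_mat, det, Wm. simpl.
  pose proof (s_ge1 (j + 1) ltac:(lia)). pose proof (s_nonneg j ltac:(lia)).
  pose proof (s_nonneg (j + 2) ltac:(lia)). pose proof (s_cassini j) as E.
  replace (S (S j)) with (j + 2)%nat in E by lia.
  replace (S j) with (j + 1)%nat in E by lia.
  repeat split; lra.
Qed.

Lemma mmul_nonneg (M N : mat) : nonneg_mat M -> nonneg_mat N -> nonneg_mat (mmul M N).
Proof.
  intros (A1 & A2 & A3 & A4 & A5) (B1 & B2 & B3 & B4 & B5).
  unfold nonneg_mat. rewrite det_mmul, A5, B5. destruct M as [a b c d], N as [a' b' c' d'].
  simpl in *.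
  repeat split; try (now ring); nra.
Qed.

Lemma wprod_nonneg (w : list nat) : letters w -> nonneg_mat (wprod w).
Proof.
  induction 1 as [|j w Hj _ IH].
  - unfold nonneg_mat, det. simpl. lra.
  - apply mmul_nonneg; [ now apply Wm_nonneg | assumption ].
Qed.

Definition tpow (e : bool) : mat := if e then Tmat else mid.

(** Since [T^2 = U^p = -I], every group element is up to sign an alternating word in [T] and powers
    of [U]; the blocks [U^(j+1) T] become letters, and a [T] may remain at either end. *)
Definition normal_form (M : mat) : Prop :=
  exists e f w, letters w /\
    (M = mmul (tpow e) (mmul (wprod w) (tpow f)) \/
     M = mneg (mmul (tpow e) (mmul (wprod w) (tpow f)))).

Lemma normal_form_neg (M : mat) : normal_form M -> normal_form (mneg M).
Proof.
  intros (e & f & w & Hw & [->| ->]); exists e, f, w; split; auto.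
  left. apply mneg_mneg.
Qed.

Lemma normal_form_intro (e f : bool) (w : list nat) :
  letters w -> normal_form (mmul (tpow e) (mmul (wprod w) (tpow f))).
Proof. intros H. exists e, f, w. auto. Qed.

Lemma normal_form_closed (X : mat) :
  (forall e f w, letters w -> normal_form (mmul X (mmul (tpow e) (mmul (wprod w) (tpow f))))) ->
  forall M, normal_form M -> normal_form (mmul X M).
Proof.
  intros H M (e & f & w & Hw & [->| ->]); [ now apply H | ].
  rewrite mmul_neg_r. apply normal_form_neg. now apply H.
Qed.

Lemma normal_form_T (M : mat) : normal_form M -> normal_form (mmul Tmat M).
Proof.
  apply normal_form_closed. intros [|] f w Hw; simpl.
  - replace (mmul Tmat (mmul Tmat (mmul (wprod w) (tpow f))))
      with (mneg (mmul mid (mmul (wprod w) (tpow f)))) by mat_ring.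
    apply normal_form_neg. now apply (normal_form_intro false).
  - rewrite mmul_id_l. now apply (normal_form_intro true).
Qed.

Lemma Umat_Wm (j : nat) : mmul (Umat l) (Wm j) = Wm (S j).
Proof.
  unfold Wm, Umat, mmul, Smat, Tmat. simpl.
  replace (j + 1)%nat with (S j) by lia. replace (j + 2)%nat with (S (S j)) by lia.
  rewrite !s_rec. f_equal; ring.
Qed.

Lemma Wm_0 : Wm 0 = Smat l.
Proof. unfold Wm. simpl. now rewrite s_2, s_1, s_0. Qed.

(** This is [- U^p T = T]: raising the letter [p - 2] leaves the alphabet and produces a [T]. *)
Lemma Wm_last : Wm (p - 1) = Tmat.
Proof.
  unfold Wm. replace (p - 1 + 1)%nat with p by lia. replace (p - 1 + 2)%nat with (S p) by lia.
  now rewrite s_succ_p, s_p, s_pred_p by lia.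
Qed.

Lemma letters_0 (w : list nat) : letters w -> letters (0%nat :: w).
Proof. intros H. constructor; [ lia | exact H ]. Qed.

(** A leading [T] is absorbed by [U T = - S] into a new letter 0. Otherwise [U] raises the first
    letter by one, and on the empty word [U = S T] creates the letter 0. *)
Lemma normal_form_U (M : mat) : normal_form M -> normal_form (mmul (Umat l) M).
Proof.
  apply normal_form_closed. intros [|] f w Hw; simpl.
  - replace (mmul (Umat l) (mmul Tmat (mmul (wprod w) (tpow f))))
      with (mneg (mmul mid (mmul (mmul (Smat l) (wprod w)) (tpow f)))) by mat_ring.
    rewrite <- Wm_0. apply normal_form_neg.
    apply (normal_form_intro false f (0%nat :: w)). now apply letters_0.
  - destruct Hw as [|j w Hj Hw].
    + replace (mmul (Umat l) (mmul mid (mmul (wprod nil) (tpow f))))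
        with (mmul (Smat l) (mmul Tmat (tpow f))) by (destruct f; mat_ring).
      rewrite <- Wm_0. destruct f; simpl.
      * replace (mmul (Wm 0) (mmul Tmat Tmat))
          with (mneg (mmul mid (mmul (mmul (Wm 0) mid) mid))) by mat_ring.
        apply normal_form_neg.
        apply (normal_form_intro false false (0%nat :: nil)). apply letters_0. constructor.
      * replace (mmul (Wm 0) (mmul Tmat mid))
          with (mmul mid (mmul (mmul (Wm 0) mid) Tmat)) by mat_ring.
        apply (normal_form_intro false true (0%nat :: nil)). apply letters_0. constructor.
    + replace (mmul (Umat l) (mmul mid (mmul (wprod (j :: w)) (tpow f))))
        with (mmul (mmul (Umat l) (Wm j)) (mmul (wprod w) (tpow f)))
        by (simpl; now rewrite mmul_id_l, !mmul_assoc).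
      rewrite Umat_Wm. destruct (Nat.eq_dec (j + 2) p) as [E|E].
      * replace (S j) with (p - 1)%nat by lia. rewrite Wm_last.
        now apply (normal_form_intro true).
      * rewrite mmul_assoc, <- mmul_id_l. apply (normal_form_intro false f (S j :: w)).
        constructor; [ lia | exact Hw ].
Qed.

Lemma mpow_U (n : nat) :
  mpow (Umat l) (S n) = Mat (s (S (S n))) (- s (S n)) (s (S n)) (- s n).
Proof.
  induction n as [|n IH].
  - simpl. rewrite s_2, s_1, s_0. mat_ring.
  - change (mpow (Umat l) (S (S n))) with (mmul (Umat l) (mpow (Umat l) (S n))).
    rewrite IH, (s_rec (S n)), (s_rec n). mat_ring.
Qed.

Lemma mpow_U_inv : madj (Umat l) = mneg (mpow (Umat l) (p - 1)).
Proof.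
  replace (p - 1)%nat with (S (p - 2)) by lia. rewrite mpow_U.
  replace (S (S (p - 2))) with p by lia.
  rewrite s_p, (s_pred_p (S (p - 2))), (s_pred2_p (p - 2)) by lia. mat_ring.
Qed.

Lemma normal_form_Uinv (M : mat) : normal_form M -> normal_form (mmul (madj (Umat l)) M).
Proof.
  intros H. rewrite mpow_U_inv, mmul_neg_l. apply normal_form_neg.
  induction (p - 1)%nat as [|n IH]; simpl; [ now rewrite mmul_id_l | ].
  rewrite <- mmul_assoc. now apply normal_form_U.
Qed.

(** The inverse is treated together with the element so that the induction passes through
    [Gp_inv]. *)
Lemma in_Gp_normal_form_mul (M : mat) :
  in_Gp l M -> forall N, normal_form N -> normal_form (mmul M N) /\ normal_form (mmul (madj M) N).
Proof.
  induction 1 as [| |M N _ IHM _ IHN|M _ IHM]; intros Q HQ.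
  - split.
    + replace (mmul (Smat l) Q) with (mneg (mmul (Umat l) (mmul Tmat Q))) by mat_ring.
      now apply normal_form_neg, normal_form_U, normal_form_T.
    + replace (mmul (madj (Smat l)) Q) with (mmul Tmat (mmul (madj (Umat l)) Q)) by mat_ring.
      now apply normal_form_T, normal_form_Uinv.
  - split; [ now apply normal_form_T | ].
    replace (mmul (madj Tmat) Q) with (mneg (mmul Tmat Q)) by mat_ring.
    now apply normal_form_neg, normal_form_T.
  - split.
    + rewrite <- mmul_assoc. now apply IHM, IHN.
    + rewrite madj_mmul, <- mmul_assoc. now apply IHN, IHM.
  - split; [ now apply IHM | ].
    replace (madj (madj M)) with M by mat_ring. now apply IHM.
Qed.

Lemma in_Gp_normal_form (M : mat) : in_Gp l M -> normal_form M.
Proof.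
  intros H. replace M with (mmul M mid) by mat_ring.
  apply (in_Gp_normal_form_mul M H).
  replace mid with (mmul (tpow false) (mmul (wprod nil) (tpow false))) by mat_ring.
  apply normal_form_intro. constructor.
Qed.

(** Up to sign and order, the off-diagonal entries of a normal form are either the diagonal entries
    of [W], which are at least 1, or its off-diagonal entries. If one of the latter vanishes,
    [det W = 1] forces the diagonal [1, 1], and the trace is 2 in absolute value. *)
Lemma hyperbolic_off_diagonal (M : mat) :
  in_Gp l M -> hyperbolic M -> mb M <> 0 /\ mc M <> 0.
Proof.
  intros HM Hh. destruct (in_Gp_normal_form M HM) as (e & f & w & Hw & HE).
  destruct (wprod_nonneg w Hw) as (A1 & A2 & A3 & A4 & A5).
  assert (Hd : mb (wprod w) * mc (wprod w) = 0 -> ma (wprod w) + md (wprod w) = 2).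
  { unfold det in A5. intros E. nra. }
  revert Hh. unfold hyperbolic. generalize dependent (wprod w).
  intros [a b c d] HE A1 A2 A3 A4 A5 Hd. simpl in *.
  assert (Hd' : b = 0 \/ c = 0 -> a + d = 2) by (intros []; subst; apply Hd; ring).
  destruct HE as [->| ->], e, f; unfold mneg, mmul, Tmat, mid; simpl; intros Hh;
    split; intros E0; try lra.
  all: assert (Ht : a + d = 2) by (apply Hd'; first [left; lra | right; lra]).
  all: revert Hh; unfold Rabs; destruct (Rcase_abs _); lra.
Qed.

(** * Pairs of conjugate hyperbolic fixed points *)

(** The fixed-point equation cleared of denominators, so that conjugation becomes a polynomial
    identity. *)
Definition qfix (M : mat) (x : R) : Prop := mc M * x * x + (md M - ma M) * x - mb M = 0.

Definition conj_pair (a b : R) : Prop :=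
  a <> b /\ exists M, in_Gp l M /\ hyperbolic M /\ qfix M a /\ qfix M b.

Lemma fixes_qfix (M : mat) (x : R) : fixes M x -> qfix M x.
Proof.
  unfold fixes, act, qfix. destruct (Req_EM_T _ 0) as [|H]; [ discriminate | ].
  intros E. injection E as E.
  assert (E' : ma M * x + mb M = x * (mc M * x + md M)) 
    by (apply (f_equal (fun t => t * (mc M * x + md M))) in E;
        unfold Rdiv in E; rewrite Rmult_assoc, Rinv_l in E by assumption; lra).
  lra.
Qed.

Lemma hecke_conjugate_conj_pair (a b : R) : hecke_conjugate l a b -> conj_pair a b.
Proof.
  intros (Hn & M & HM & Hh & Ha & Hb). split; [ auto | ].
  exists M. repeat split; auto using fixes_qfix.
Qed.

Lemma conj_pair_sym (a b : R) : conj_pair a b -> conj_pair b a.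
Proof. intros (Hn & M & H1 & H2 & H3 & H4). split; [ auto | ]. exists M. auto. Qed.

Lemma conj_pair_nonzero (a b : R) : conj_pair a b -> a <> 0.
Proof.
  intros (_ & M & HM & Hh & Ha & _) E. apply (proj1 (hyperbolic_off_diagonal M HM Hh)).
  unfold qfix in Ha. rewrite E in Ha. lra.
Qed.

(** [f] stands for the action of [N]; conjugation by [N] keeps the trace because [det N = 1]. *)
Lemma conj_pair_conjugate (N : mat) (f : R -> R) (a b : R) :
  in_Gp l N -> f a <> f b ->
  (forall M x, x = a \/ x = b -> qfix M x -> qfix (mmul N (mmul M (madj N))) (f x)) ->
  conj_pair a b -> conj_pair (f a) (f b).
Proof.
  intros HN Hf H (_ & M & HM & Hh & Ha & Hb). split; [ exact Hf | ].
  exists (mmul N (mmul M (madj N))). repeat split; auto.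
  - now repeat (apply Gp_mul || apply Gp_inv).
  - unfold hyperbolic in *. pose proof (in_Gp_det N HN) as HD.
    replace (ma (mmul N (mmul M (madj N))) + md (mmul N (mmul M (madj N))))
      with ((ma M + md M) * det N) by (unfold det; destruct M, N; simpl; ring).
    now rewrite HD, Rmult_1_r.
Qed.

Lemma conj_pair_add (a b : R) : conj_pair a b -> conj_pair (a + l) (b + l).
Proof.
  intros H. apply (conj_pair_conjugate (Smat l) (fun x => x + l)); auto using Gp_S.
  - destruct H as [Hn _]. intros E. apply Hn. lra.
  - intros [] x _. unfold qfix. simpl. intros E. etransitivity; [ | exact E ]. ring.
Qed.

Lemma conj_pair_sub (a b : R) : conj_pair a b -> conj_pair (a - l) (b - l).
Proof.
  intros H. apply (conj_pair_conjugate (madj (Smat l)) (fun x => x - l)); auto using Gp_S, Gp_inv.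
  - destruct H as [Hn _]. intros E. apply Hn. lra.
  - intros [] x _. unfold qfix. simpl. intros E. etransitivity; [ | exact E ]. ring.
Qed.

Lemma conj_pair_inv (a b : R) : conj_pair a b -> conj_pair (- / a) (- / b).
Proof.
  intros H. pose proof (conj_pair_nonzero _ _ H) as Ha.
  pose proof (conj_pair_nonzero _ _ (conj_pair_sym _ _ H)) as Hb.
  apply (conj_pair_conjugate Tmat (fun x => - / x)); auto using Gp_T.
  - destruct H as [Hn _]. intros E. apply Hn. apply Ropp_eq_reg in E. now apply Rinv_eq_reg.
  - intros [a0 b0 c0 d0] x Hx. unfold qfix. simpl. intros E.
    assert (x <> 0) by (destruct Hx; congruence).
    apply Rmult_eq_reg_r with (x * x); [ | now apply Rmult_integral_contrapositive_currified ].
    transitivity (c0 * x * x + (d0 - a0) * x - b0); [ field; assumption | lra ].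
Qed.

Lemma conj_pair_shift (z : Z) (a b : R) :
  conj_pair a b -> conj_pair (a + IZR z * l) (b + IZR z * l).
Proof.
  assert (H : forall n a b, conj_pair a b -> conj_pair (a + INR n * l) (b + INR n * l)
                 /\ conj_pair (a - INR n * l) (b - INR n * l)).
  { induction n as [|n IH]; intros c d Hcd.
    - simpl. rewrite !Rmult_0_l, !Rplus_0_r, !Rminus_0_r. auto.
    - destruct (IH c d Hcd) as [H1 H2]. rewrite S_INR.
      apply conj_pair_add in H1. apply conj_pair_sub in H2. split.
      + replace (c + (INR n + 1) * l) with (c + INR n * l + l) by ring.
        now replace (d + (INR n + 1) * l) with (d + INR n * l + l) by ring.
      + replace (c - (INR n + 1) * l) with (c - INR n * l - l) by ring.
        now replace (d - (INR n + 1) * l) with (d - INR n * l - l) by ring. }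
  intros Hab. destruct z as [|q|q].
  - rewrite !Rmult_0_l, !Rplus_0_r. assumption.
  - rewrite <- (positive_nat_Z q), <- INR_IZR_INZ. now apply H.
  - change (Z.neg q) with (- Z.pos q)%Z.
    rewrite opp_IZR, <- (positive_nat_Z q), <- INR_IZR_INZ.
    replace (a + - INR (Pos.to_nat q) * l) with (a - INR (Pos.to_nat q) * l) by ring.
    replace (b + - INR (Pos.to_nat q) * l) with (b - INR (Pos.to_nat q) * l) by ring.
    now apply H.
Qed.

Lemma conj_pair_ne_mul (z : Z) (a b : R) : conj_pair a b -> a <> IZR z * l.
Proof.
  intros H E. apply (conj_pair_shift (- z)) in H. apply conj_pair_nonzero in H.
  apply H. rewrite E, opp_IZR. ring.
Qed.

Lemma conj_pair_reflect (z : Z) (a b : R) :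
  conj_pair a b -> conj_pair (/ (IZR z * l - a)) (/ (IZR z * l - b)).
Proof.
  intros H. apply (conj_pair_shift (- z)) in H. apply conj_pair_inv in H.
  rewrite opp_IZR, <- !Rinv_opp in H.
  replace (IZR z * l - a) with (- (a + - IZR z * l)) by ring.
  now replace (IZR z * l - b) with (- (b + - IZR z * l)) by ring.
Qed.

Definition cpair (q : R * R) : Prop := conj_pair (fst q) (snd q).

Lemma cpair_pstep (q : R * R) : cpair q -> cpair (pstep q).
Proof. intros H. apply conj_pair_reflect. exact H. Qed.

Lemma cpair_piter (n : nat) (q : R * R) : cpair q -> cpair (piter n q).
Proof.
  intros H. induction n as [|n IH]; [ exact H | ]. rewrite piter_Sout. now apply cpair_pstep.
Qed.

(** Steps with digit 1 pull [U^(k+2)(0)] back to [l], a translate of 0. This makes the weak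
    inequality in [cell] strict. *)
Lemma conj_pair_not_cusp (k : nat) (a b : R) :
  conj_pair a b -> a * s (k + 1) <> s (k + 2).
Proof.
  replace (k + 2)%nat with (S (S k)) by lia. replace (k + 1)%nat with (S k) by lia.
  revert a b. induction k as [|k IH]; intros a b H E.
  - rewrite s_2, s_1 in E. apply (conj_pair_ne_mul 1 _ _ H). lra.
  - pose proof (conj_pair_ne_mul 1 _ _ H) as Hn.
    apply (conj_pair_reflect 1) in H. rewrite Rmult_1_l in *.
    apply (IH _ _ H). rewrite (s_rec (S k)) in E.
    apply Rmult_eq_reg_l with (l - a); [ | lra ].
    rewrite <- Rmult_assoc, Rinv_r by lra. lra.
Qed.

(** * The reduced region *)

Definition reduced_at (k : nat) (q : R * R) : Prop :=
  (k + 3 <= p)%nat /\ 0 < snd q /\ snd q * s (k + 1) < s (k + 2) /\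
  s (k + 2) < fst q * s (k + 1) /\ fst q * s k < s (k + 1).

Definition reduced_pair (q : R * R) : Prop := exists k, reduced_at k q.

Lemma reduced_at_cell (k : nat) (q : R * R) : reduced_at k q -> cell k (fst q).
Proof. intros (H1 & _ & _ & H2 & H3). unfold cell. repeat split; [ lia | lra | lra ]. Qed.

Lemma reduced_at_0 (q : R * R) : reduced_at 0 q <-> 0 < snd q < l /\ l < fst q.
Proof.
  unfold reduced_at. simpl. rewrite s_2, s_1, s_0.
  split; intros; [ lra | repeat split; [ lia | lra .. ] ].
Qed.

Lemma reduced_at_S (k : nat) (a b : R) : reduced_at (S k) (a, b) ->
  pstep (a, b) = (/ (l - a), / (l - b)) /\ reduced_at k (/ (l - a), / (l - b)).
Proof.
  intros H. split.
  - apply pstep_one. apply (cell_S_digit k). now apply (reduced_at_cell _ _ H).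
  - destruct H as (Hk & H1 & H2 & H3 & H4). simpl in *.
    assert (Ha : a < l) by (apply (below_lam k); [ lia | assumption ]).
    replace (k + 1)%nat with (S k) in * by lia. replace (k + 2)%nat with (S (S k)) in * by lia.
    assert (Hb : b < l).
    { apply (below_lam (S k)); [ lia | ]. now replace (S (S k) + 1)%nat with (S (S (S k))) by lia. }
    unfold reduced_at. simpl.
    replace (k + 1)%nat with (S k) in * by lia. replace (k + 2)%nat with (S (S k)) in * by lia.
    split; [ lia | ].
    split; [ apply Rinv_0_lt_compat; lra | ].
    split; [ now apply shift_lt | ].
    split; [ now apply shift_gt | now apply shift_lt ].
Qed.

(** The digit is at least 2, so the second denominator exceeds [l] and the second image lies in
    [(0, 1 / l)]. The first image is at least [1 / l], hence in a cell [k <= p - 3], whose lower end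
    is at least [1 / l]. *)
Lemma straddle_step_reduced (q : R * R) :
  cpair q -> l < fst q -> snd q < l -> reduced_pair (pstep q).
Proof.
  intros Hc Ha Hb. pose proof lam_ge1 as Hl.
  pose proof (cpair_pstep q Hc) as Hc'.
  destruct (cell_exists_strong _ (pstep_fst_ge q)) as (k & Hk & HI).
  exists k. destruct HI as (_ & H1 & H2).
  assert (Hr := digit_ge2 (fst q) ltac:(lra)).
  assert (E : snd (pstep q) = / (IZR (cf_digit l (fst q)) * l - snd q)) by reflexivity.
  set (t := IZR (cf_digit l (fst q)) * l - snd q) in *.
  assert (Ht : l < t) by (unfold t; nra).
  split; [ exact Hk | ]. split; [ rewrite E; apply Rinv_0_lt_compat; lra | ].
  split; [ | split; [ | exact H2 ] ].
  - rewrite E. pose proof (s_nonneg (S (S (k + 1))) ltac:(lia)) as Hs.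
    rewrite s_rec in Hs. replace (S (k + 1)) with (k + 2)%nat in Hs by lia.
    pose proof (s_pos (k + 2) ltac:(lia)).
    apply Rmult_lt_reg_l with t; [ lra | ]. rewrite <- Rmult_assoc, Rinv_r by lra. nra.
  - apply Rle_lt_or_eq_dec in H1. destruct H1 as [H1|H1]; [ exact H1 | ].
    exfalso. symmetry in H1. exact (conj_pair_not_cusp k _ _ Hc' H1).
Qed.

Lemma reduced_pstep (q : R * R) : cpair q -> reduced_pair q -> reduced_pair (pstep q).
Proof.
  intros Hc [[|k] H].
  - apply reduced_at_0 in H. now apply straddle_step_reduced.
  - destruct q as [a b]. destruct (reduced_at_S k a b H) as [-> H']. now exists k.
Qed.

Lemma reduced_piter (n : nat) (q : R * R) : cpair q -> reduced_pair q -> reduced_pair (piter n q).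
Proof.
  intros Hc H. induction n as [|n IH]; [ exact H | ].
  rewrite piter_Sout. apply reduced_pstep; [ now apply cpair_piter | exact IH ].
Qed.

(** The translated first component is at least [l], which forces index 0 and a second component
    below [l]; but that one has been moved above [l]. *)
Lemma reduced_translate (q : R * R) (t : R) :
  1 <= t -> reduced_pair q -> ~ reduced_pair (fst q + t * l, snd q + t * l).
Proof.
  intros Ht [k H] [k' H']. pose proof lam_ge1.
  pose proof (cell_pos _ _ (reduced_at_cell _ _ H)).
  assert (0 < snd q) by apply H. destruct k' as [|k'].
  - apply reduced_at_0 in H'. simpl in H'. nra.
  - destruct H' as (Hk & _ & _ & _ & H'). simpl in H'.
    apply (below_lam k') in H'; [ | lia ]. nra.
Qed.

Lemma reduced_translate_Z (q : R * R) (z : Z) :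
  reduced_pair q -> reduced_pair (fst q + IZR z * l, snd q + IZR z * l) -> z = 0%Z.
Proof.
  intros H H'. destruct (Z.lt_trichotomy z 0) as [Hz|[Hz|Hz]]; [ exfalso | exact Hz | exfalso ].
  - apply (reduced_translate _ (IZR (- z)) (IZR_le 1 (- z) ltac:(lia)) H'). simpl.
    rewrite opp_IZR.
    replace (fst q + IZR z * l + - IZR z * l) with (fst q) by ring.
    replace (snd q + IZR z * l + - IZR z * l) with (snd q) by ring.
    now destruct q.
  - apply (reduced_translate _ (IZR z) (IZR_le 1 z ltac:(lia)) H H').
Qed.

(** * Periodicity of reduced pairs *)

Definition mob (M : mat) (x : R) : R := (ma M * x + mb M) / (mc M * x + md M).

Lemma nonneg_denom (M : mat) (x : R) : nonneg_mat M -> 0 < x -> 0 < mc M * x + md M.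
Proof. intros (_ & _ & H3 & H4 & _) Hx. nra. Qed.

Lemma nonneg_adj_denom (M : mat) (x : R) :
  nonneg_mat M -> x < 0 -> 0 < mc (madj M) * x + md (madj M).
Proof. intros (H1 & _ & H3 & _ & _) Hx. simpl. nra. Qed.

Lemma mob_pos (M : mat) (x : R) : nonneg_mat M -> 0 < x -> 0 < mob M x.
Proof.
  intros HM Hx. apply Rdiv_lt_0_compat; [ | now apply nonneg_denom ].
  destruct HM as (H1 & H2 & _). nra.
Qed.

Lemma mob_adj_neg (M : mat) (x : R) : nonneg_mat M -> x < 0 -> mob (madj M) x < 0.
Proof.
  intros HM Hx. pose proof (nonneg_adj_denom M x HM Hx).
  destruct HM as (_ & H2 & _ & H4 & _). unfold mob. simpl in *.
  apply Rmult_lt_reg_r with (- mc M * x + ma M); [ assumption | ].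
  unfold Rdiv. rewrite Rmult_assoc, Rinv_l by lra. nra.
Qed.

Lemma mob_mmul (M N : mat) (x : R) :
  mc N * x + md N <> 0 -> mc (mmul M N) * x + md (mmul M N) <> 0 ->
  mob (mmul M N) x = mob M (mob N x).
Proof.
  intros H1 H2. destruct M, N. unfold mob. simpl in *. field. split; [ assumption | ].
  intros E. apply H2. rewrite <- E. ring.
Qed.

Lemma mob_Wm_cell (j : nat) (z : R) : (j + 1 < p)%nat -> 0 < z -> cell j (mob (Wm j) z).
Proof.
  intros Hj Hz. pose proof (nonneg_denom _ z (Wm_nonneg j Hj) Hz) as HD.
  unfold cell, mob, Wm in *. simpl in *. pose proof (s_cassini j) as E.
  replace (S (S j)) with (j + 2)%nat in E by lia.
  replace (S j) with (j + 1)%nat in E by lia.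
  set (D := s j * z + s (j + 1)) in *. split; [ exact Hj | ].
  assert (EN : (s (j + 1) * z + s (j + 2)) / D * D = s (j + 1) * z + s (j + 2)) by (field; lra).
  set (x := _ / D) in *. pose proof (s_pos (j + 1) ltac:(lia)). split.
  - apply Rmult_le_reg_r with D; [ exact HD | ].
    replace (x * s (j + 1) * D) with (x * D * s (j + 1)) by ring. rewrite EN.
    assert (0 <= z * (s (j + 1) * s (j + 1) - s j * s (j + 2))) by (rewrite E; lra).
    unfold D. lra.
  - apply Rmult_lt_reg_r with D; [ exact HD | ].
    replace (x * s j * D) with (x * D * s j) by ring. rewrite EN. unfold D. nra.
Qed.

(** [Wm i] acts as [U^(i+1) T], so [i] applications of [U^-1] leave [U T], which acts as translation
    by [l]. On the second component the same map is this translation after the inverse of [Wm i]. *)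
Lemma piter_letter (j : nat) (z y : R) :
  (S j + 1 < p)%nat -> 0 < z -> y < 0 ->
  piter (S j) (mob (Wm (S j)) z + l, y + l) = (z + l, mob (madj (Wm (S j))) y + l).
Proof.
  intros Hj Hz Hy. pose proof (mob_Wm_cell _ z Hj Hz) as HI.
  pose proof (nonneg_denom _ z (Wm_nonneg (S j) Hj) Hz) as HD.
  pose proof (nonneg_adj_denom _ y (Wm_nonneg (S j) Hj) Hy) as HD'.
  pose proof (s_pos (S j) ltac:(lia)) as P1. pose proof (s_pos (S (S j)) ltac:(lia)) as P2.
  set (x := mob (Wm (S j)) z) in *.
  assert (Ex : x * (s (S j) * z + s (S (S j))) = s (S (S j)) * z + s (S (S (S j)))).
  { unfold x, mob, Wm in *. simpl in *.
    replace (j + 1)%nat with (S j) in * by lia. replace (j + 2)%nat with (S (S j)) in * by lia.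
    field. lra. }
  (* The first digit absorbs the added [l], so the run-of-ones formula applies to the untranslated
     pair. *)
  rewrite piter_S. replace l with (INR 1 * l) at 1 2 by (simpl; ring).
  rewrite pstep_add, <- piter_S, piter_cell by (try assumption; nra).
  assert (HU : s (S (S j)) - s (S j) * x <> 0).
  { destruct HI as (_ & _ & HI). replace (S j + 1)%nat with (S (S j)) in HI by lia. lra. }
  pose proof (s_cassini j) as E1. pose proof (s_cassini (S j)) as E2.
  pose proof (s_rec j) as R1. pose proof (s_rec (S j)) as R2.
  assert (HD0 : 0 < s (S j) * z + s (S (S j))) by nra.
  f_equal.
  - apply Rmult_eq_reg_r with (s (S (S j)) - s (S j) * x); [ | exact HU ].
    unfold Rdiv. rewrite Rmult_assoc, Rinv_l, Rmult_1_r by exact HU.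
    apply Rmult_eq_reg_r with (s (S j) * z + s (S (S j))); [ | lra ].
    transitivity ((z + l) * (s (S j) * s (S j) - s j * s (S (S j)))).
    + transitivity (s (S j) * (s (S j) * z + s (S (S j))) -
        s j * (x * (s (S j) * z + s (S (S j))))); [ ring | ].
      rewrite Ex, R2, R1. ring.
    + rewrite E1, <- E2.
      transitivity ((z + l) * (s (S (S j)) * (s (S j) * z + s (S (S j))) -
        s (S j) * (x * (s (S j) * z + s (S (S j)))))); [ | ring ].
      rewrite Ex. ring.
  - unfold mob, Wm in *. simpl in *.
    replace (j + 1)%nat with (S j) in * by lia. replace (j + 2)%nat with (S (S j)) in * by lia.
    replace (s j) with (l * s (S j) - s (S (S j))) by lra. rewrite R2.
    field. lra.
Qed.

(** A letter [j] costs [j] steps. The letter 0 is a translation and costs none: the next step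
    absorbs it, and [n] counts the translations after which no step follows. *)
Lemma piter_word (w : list nat) : letters w ->
  forall y x', 0 < y -> x' < 0 ->
  exists n : nat, piter (list_sum w) (mob (wprod w) y + l, x' + l) =
    (y + l + INR n * l, mob (madj (wprod w)) x' + l + INR n * l).
Proof.
  induction 1 as [|j w Hj Hw IH]; intros y x' Hy Hx'.
  - exists O. unfold piter, mob. simpl. f_equal; field.
  - pose proof (wprod_nonneg w Hw) as HW. pose proof (Wm_nonneg j Hj) as HJ.
    pose proof (wprod_nonneg (j :: w) (Forall_cons j Hj Hw)) as HJW.
    pose proof (nonneg_denom _ y HW Hy). pose proof (nonneg_adj_denom _ x' HJ Hx').
    pose proof (nonneg_denom _ y HJW Hy). pose proof (nonneg_adj_denom _ x' HJW Hx').
    change (wprod (j :: w)) with (mmul (Wm j) (wprod w)) in *.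
    rewrite madj_mmul in *. rewrite !mob_mmul by lra.
    pose proof (mob_pos _ _ HW Hy) as Hz. pose proof (mob_adj_neg _ _ HJ Hx') as Hz'.
    destruct (IH y _ Hy Hz') as [n Hn].
    destruct j as [|j].
    + rewrite Wm_0 in *. simpl list_sum. clear HJ HJW.
      assert (E1 : mob (Smat l) (mob (wprod w) y) = mob (wprod w) y + INR 1 * l)
        by (unfold mob at 1; simpl; field).
      assert (E2 : x' = mob (madj (Smat l)) x' + INR 1 * l) by (unfold mob; simpl; field).
      set (z' := mob (madj (Smat l)) x') in *. set (z := mob (wprod w) y) in *.
      rewrite E1, E2.
      replace (z + INR 1 * l + l) with (z + l + INR 1 * l) by ring.
      replace (z' + INR 1 * l + l) with (z' + l + INR 1 * l) by ring.
      destruct (list_sum w) as [|m].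
      * exists (S n). unfold piter in *. simpl Nat.iter in *. injection Hn as H3 H4.
        rewrite H3, H4, S_INR. simpl. f_equal; ring.
      * exists n. rewrite piter_S, pstep_add, <- piter_S. exact Hn.
    + exists n. change (list_sum (S j :: w)) with (S j + list_sum w)%nat.
      rewrite Nat.add_comm, piter_add, piter_letter by assumption. exact Hn.
Qed.

Lemma wprod_translation (w : list nat) : list_sum w = 0%nat -> mc (wprod w) = 0.
Proof.
  induction w as [|j w IH]; [ reflexivity | ].
  change (list_sum (j :: w)) with (j + list_sum w)%nat. intros H.
  assert (j = 0)%nat as -> by lia.
  change (wprod (0%nat :: w)) with (mmul (Wm 0) (wprod w)).
  rewrite Wm_0. simpl. rewrite IH by lia. ring.
Qed.

(** The sign conditions rule out a [T] at either end: in [T W] and [W T] the off-diagonal entries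
    have opposite signs, and in [T W T] the trace is negative while the off-diagonal entries are
    nonnegative. *)
Lemma same_sign_word (M : mat) :
  in_Gp l M -> 0 < mb M * mc M -> 0 < (ma M + md M) * mb M ->
  exists w, letters w /\ (M = wprod w \/ M = mneg (wprod w)).
Proof.
  intros HM Hbc Ht. destruct (in_Gp_normal_form M HM) as (e & f & w & Hw & HE).
  exists w. split; [ exact Hw | ].
  destruct (wprod_nonneg w Hw) as (A1 & A2 & A3 & A4 & A5). clear HM Hw.
  generalize dependent (wprod w). intros [a b c d] HE A1 A2 A3 A4 A5. simpl in *.
  destruct HE as [->| ->], e, f; unfold mneg, mmul, Tmat, mid in *; simpl in *;
    try (exfalso; nra); [ left | right ]; f_equal; ring.
Qed.

(** The product of the roots is [- mb M / mc M], so opposite signs give [0 < mb M * mc M]. Passing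
    to the inverse flips [mb] and keeps the trace, which arranges the second sign condition. *)
Lemma opposite_signs_word (x y : R) :
  conj_pair x y -> y < 0 < x ->
  exists w, letters w /\ mc (wprod w) <> 0 /\ qfix (wprod w) x /\ qfix (wprod w) y.
Proof.
  intros (_ & M & HM & Hh & Hx & Hy) [Hyn Hxp].
  pose proof (hyperbolic_off_diagonal M HM Hh) as [Hb Hc].
  assert (Hbc : 0 < mb M * mc M).
  { assert (E : mb M = - mc M * x * y).
    { unfold qfix in *. assert (E : (x - y) * (mc M * x * y + mb M) = 0).
      { transitivity (y * (mc M * x * x + (md M - ma M) * x - mb M) -
          x * (mc M * y * y + (md M - ma M) * y - mb M)); [ ring | rewrite Hx, Hy; ring ]. }
      apply Rmult_integral in E. destruct E; lra. }
    assert (0 < mc M * mc M) by nra. assert (x * y < 0) by nra.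
    rewrite E. nra. }
  assert (Hw : exists N w, letters w /\ (N = wprod w \/ N = mneg (wprod w)) /\
            mc N <> 0 /\ qfix N x /\ qfix N y).
  { assert (Ht : ma M + md M <> 0).
    { unfold hyperbolic in Hh. intros E. rewrite E, Rabs_R0 in Hh. lra. }
    destruct (Rtotal_order ((ma M + md M) * mb M) 0) as [H|[H|H]].
    - destruct (same_sign_word (madj M)) as (w & Hw);
        [ now apply Gp_inv | simpl; lra | simpl; lra | ].
      exists (madj M), w. unfold qfix in *. simpl. repeat split; [ apply Hw .. | lra | lra | lra ].
    - apply Rmult_integral in H. tauto.
    - destruct (same_sign_word M HM Hbc H) as (w & Hw).
      exists M, w. repeat split; try apply Hw; assumption. }
  destruct Hw as (N & w & Hw & HE & HN). exists w. split; [ exact Hw | ].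
  destruct HE as [->| ->]; [ exact HN | ]. unfold qfix in *. simpl in HN.
  repeat split; lra.
Qed.

Lemma reduced_periodic_0 (q : R * R) :
  cpair q -> reduced_at 0 q -> exists n, (1 <= n)%nat /\ piter n q = q.
Proof.
  intros Hc HQ. pose proof HQ as HR. apply reduced_at_0 in HQ.
  destruct q as [a b]. unfold cpair in Hc. simpl in *.
  destruct (opposite_signs_word (a - l) (b - l)) as (w & Hw & Hcw & Hx & Hy);
    [ now apply conj_pair_sub | lra | ].
  pose proof (wprod_nonneg w Hw) as HW.
  pose proof (nonneg_denom _ (a - l) HW ltac:(lra)) as D1.
  pose proof (nonneg_adj_denom _ (b - l) HW ltac:(lra)) as D2.
  destruct (piter_word w Hw (a - l) (b - l)) as [n Hn]; [ lra | lra | ].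
  assert (E1 : mob (wprod w) (a - l) = a - l).
  { unfold qfix in Hx. unfold mob.
    apply Rmult_eq_reg_r with (mc (wprod w) * (a - l) + md (wprod w)); [ | lra ].
    unfold Rdiv. rewrite Rmult_assoc, Rinv_l; lra. }
  assert (E2 : mob (madj (wprod w)) (b - l) = b - l).
  { unfold qfix in Hy. unfold mob. simpl in *.
    apply Rmult_eq_reg_r with (- mc (wprod w) * (b - l) + ma (wprod w)); [ | lra ].
    unfold Rdiv. rewrite Rmult_assoc, Rinv_l; lra. }
  rewrite E1, E2 in Hn.
  replace (a - l + l) with a in Hn by ring. replace (b - l + l) with b in Hn by ring.
  exists (list_sum w). split.
  - destruct (list_sum w) eqn:E; [ | lia ]. exfalso. apply Hcw. now apply wprod_translation.
  (* The word brings the pair back up to a translation; both pairs lie in the region, so the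
     translation is trivial. *)
  - assert (HP : reduced_pair (piter (list_sum w) (a, b)))
      by (apply reduced_piter; [ exact Hc | now exists 0%nat ]).
    rewrite Hn, INR_IZR_INZ in HP.
    apply (reduced_translate_Z (a, b)) in HP; [ | now exists 0%nat ].
    rewrite Hn, INR_IZR_INZ, HP. f_equal; ring.
Qed.

Lemma pstep_eq (q q' : R * R) : pstep q = pstep q' ->
  let z := (cf_digit l (fst q) - cf_digit l (fst q'))%Z in
  q = (fst q' + IZR z * l, snd q' + IZR z * l).
Proof.
  unfold pstep. intros H. injection H as H1 H2. apply Rinv_eq_reg in H1. apply Rinv_eq_reg in H2.
  destruct q, q'. simpl in *. rewrite minus_IZR. f_equal; lra.
Qed.

(** The image of index [k + 1] has index [k] and returns to itself. Steps are injective up to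
    translation, and no nontrivial translation stays in the region, so the pair itself returns. *)
Lemma reduced_periodic (q : R * R) :
  cpair q -> reduced_pair q -> exists n, (1 <= n)%nat /\ piter n q = q.
Proof.
  intros Hc [k HQ]. revert q Hc HQ. induction k as [|k IH]; intros q Hc HQ.
  - now apply reduced_periodic_0.
  - destruct (IH (pstep q)) as (n & Hn & E); [ now apply cpair_pstep | | ].
    { destruct q as [a b]. destruct (reduced_at_S k a b HQ) as [-> H]. exact H. }
    exists n. split; [ exact Hn | ].
    rewrite <- piter_S, piter_Sout in E. apply pstep_eq in E. simpl in E.
    assert (HP : reduced_pair (piter n q))
      by (apply reduced_piter; [ exact Hc | now exists (S k) ]).
    rewrite E in HP. apply reduced_translate_Z in HP; [ | now exists (S k) ].
    rewrite E, HP. destruct q. simpl. f_equal; ring.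
Qed.

(** * Separation *)

(** The second component never meets the pole of the next step, and [l] never falls between the two
    components as in [straddle_step_reduced]. *)
Definition unseparated (q : R * R) : Prop := forall n,
  snd (piter n q) <> IZR (cf_digit l (fst (piter n q))) * l /\
  (l <= fst (piter n q) -> l <= snd (piter n q)).

Lemma unseparated_pstep (q : R * R) : unseparated q -> unseparated (pstep q).
Proof. intros H n. rewrite <- piter_S. apply H. Qed.

(* Coordinates of the vector [(A, C)] with respect to the columns of [Wm i], which
   span the cone over [cell i]. *)
Definition ucoord (i : nat) (A C : R) : R := s (i + 1) * A - s (i + 2) * C.
Definition vcoord (i : nat) (A C : R) : R := s (i + 1) * C - s i * A.

Lemma coords_one (i : nat) (A C : R) :
  ucoord (S i) (l * A - C) A = ucoord i A C /\ vcoord (S i) (l * A - C) A = vcoord i A C.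
Proof.
  unfold ucoord, vcoord. replace (S i + 1)%nat with (S (S i)) by lia.
  replace (S i + 2)%nat with (S (S (S i))) by lia.
  replace (i + 1)%nat with (S i) by lia. replace (i + 2)%nat with (S (S i)) by lia.
  rewrite (s_rec (S i)), (s_rec i). split; ring.
Qed.

(** The vector is a nonnegative combination of the columns of [Wm i]. Its new [vcoord] is
    [A = s (i+1) * u + s (i+2) * v], and its new [ucoord] is at least
    [l * A - C = s (i+2) * u + s (i+3) * v]. *)
Lemma coords_big (i : nat) (r A C : R) :
  (i + 3 <= p)%nat -> 2 <= r -> 0 <= ucoord i A C -> 0 <= vcoord i A C ->
  ucoord i A C <= ucoord 0 (r * l * A - C) A /\
  vcoord i A C + ucoord i A C <= vcoord 0 (r * l * A - C) A.
Proof.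
  intros Hi Hr Hu Hv. pose proof (s_cassini i) as E.
  assert (EA : A = s (S i) * ucoord i A C + s (S (S i)) * vcoord i A C).
  { transitivity (A * (s (S i) * s (S i) - s i * s (S (S i)))); [ rewrite E; ring | ].
    unfold ucoord, vcoord. replace (i + 1)%nat with (S i) by lia.
    replace (i + 2)%nat with (S (S i)) by lia. ring. }
  assert (EC : C = s i * ucoord i A C + s (S i) * vcoord i A C).
  { transitivity (C * (s (S i) * s (S i) - s i * s (S (S i)))); [ rewrite E; ring | ].
    unfold ucoord, vcoord. replace (i + 1)%nat with (S i) by lia.
    replace (i + 2)%nat with (S (S i)) by lia. ring. }
  set (u := ucoord i A C) in *. set (v := vcoord i A C) in *.
  pose proof (s_ge1 (S i) ltac:(lia)). pose proof (s_ge1 (S (S i)) ltac:(lia)).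
  pose proof (s_nonneg (S (S (S i))) ltac:(lia)) as H3.
  pose proof lam_ge1.
  unfold ucoord, vcoord. simpl. rewrite s_2, s_1, s_0.
  assert (HA : 0 <= A) by (rewrite EA; nra).
  assert (HAC : l * A - C = s (S (S i)) * u + s (S (S (S i))) * v)
    by (rewrite EA, EC, (s_rec (S i)), (s_rec i); ring).
  assert (0 <= (r - 2) * (l * A)) by (apply Rmult_le_pos; nra).
  split; nra.
Qed.

(** If [(A, C)] represents the image [1 / (z - c)], then [(z * A - C, A)] represents [c]. *)
Lemma vector_pullback (z c A C : R) :
  z - c <> 0 -> A = / (z - c) * C -> z * A - C = c * A.
Proof.
  intros H E. assert (E' : (z - c) * A = C) by (rewrite E; field; assumption). lra.
Qed.

(* Pulling the vectors [(a_N, 1)] and [(b_N, 1)] back along the expansion keeps their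
   determinant, while each digit other than 1 adds [ucoord] to [vcoord]. *)
Lemma pullback_vectors (n i : nat) (a b : R) :
  cell i a -> (i + 3 <= p)%nat -> unseparated (a, b) ->
  exists A C A' C' x y, 0 <= x /\ 0 <= y /\ A = a * C /\ A' = b * C' /\
    A * C' - A' * C = x - y /\
    x <= ucoord i A C /\ 1 + INR n * x <= vcoord i A C /\
    y <= ucoord i A' C' /\ 1 + INR n * y <= vcoord i A' C'.
Proof.
  revert i a b. induction n as [|n IHn]; induction i as [|i IHi]; intros a b HI Hi Hg.
  (* The two cases with digit 1: the coordinates, and hence all bounds, are unchanged. *)
  2, 4: destruct (IHi (/ (l - a)) (/ (l - b)))
      as (A & C & A' & C' & x & y & H1 & H2 & H3 & H4 & H5 & H6);
    [ now apply cell_S_step | lia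
    | rewrite <- (pstep_one a b) by (now apply (cell_S_digit i)); now apply unseparated_pstep | ];
    exists (l * A - C), A, (l * A' - C'), A', x, y;
    destruct (coords_one i A C) as [-> ->]; destruct (coords_one i A' C') as [-> ->];
    assert (Ha : l - a <> 0)
      by (destruct HI as (_ & _ & HI); apply below_lam in HI; [ lra | lia ]);
    assert (Hb : l - b <> 0)
      by (destruct (Hg 0%nat) as [Hb _]; simpl in Hb; rewrite (cell_S_digit i a HI) in Hb; lra);
    rewrite (vector_pullback l a A C Ha H3), (vector_pullback l b A' C' Hb H4) in *;
    repeat split; try tauto;
    rewrite <- H5, <- (vector_pullback l a A C Ha H3), <- (vector_pullback l b A' C' Hb H4); ring.
  (* In cell 0 the vectors [(a, 1)] and [(b, 1)] have [ucoord] equal to [a - l] and [b - l]; the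
     latter is nonnegative as the pair is unseparated. *)
  - exists a, 1, b, 1, (a - l), (b - l). apply cell_0 in HI.
    destruct (Hg 0%nat) as [_ Hb]. specialize (Hb HI). simpl in Hb.
    unfold ucoord, vcoord. simpl. rewrite s_2, s_1, s_0. repeat split; lra.
  - apply cell_0 in HI.
    destruct (cell_exists_strong _ (pstep_fst_ge (a, b))) as (i & Hi' & HI').
    destruct (IHn i (fst (pstep (a, b))) (snd (pstep (a, b))))
      as (A & C & A' & C' & x & y & H1 & H2 & H3 & H4 & H5 & H6 & H7 & H8 & H9);
      [ assumption | assumption | | ].
    { rewrite <- surjective_pairing. now apply unseparated_pstep. }
    pose proof (digit_ge2 a HI) as Hr. pose proof (digit_bounds a) as Hd.
    destruct (Hg 0%nat) as [Hb _]. simpl in Hb.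
    change (fst (pstep (a, b))) with (/ (IZR (cf_digit l a) * l - a)) in H3.
    change (snd (pstep (a, b))) with (/ (IZR (cf_digit l a) * l - b)) in H4.
    set (r := IZR (cf_digit l a)) in *. pose proof (pos_INR n) as Hn.
    assert (0 <= INR n * x) by (apply Rmult_le_pos; lra).
    assert (0 <= INR n * y) by (apply Rmult_le_pos; lra).
    destruct (coords_big i r A C) as [B1 B2]; [ assumption | lra | lra | lra | ].
    destruct (coords_big i r A' C') as [B3 B4]; [ assumption | lra | lra | lra | ].
    exists (r * l * A - C), A, (r * l * A' - C'), A', x, y. rewrite S_INR.
    split; [ exact H1 | ]. split; [ exact H2 | ].
    split; [ apply vector_pullback; [ lra | exact H3 ] | ].
    split; [ apply vector_pullback; [ lra | exact H4 ] | ].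
    repeat split; lra.
Qed.

(** In cell 0 [vcoord] is the lower entry, so [C >= 1 + n x] and [C' >= 1 + n y], while
    [(a - b) C C' = x - y]. Hence [n |a - b| <= 1] for every [n]. *)
Lemma unseparated_eq (a b : R) : l <= a -> unseparated (a, b) -> a = b.
Proof.
  intros Ha Hg.
  assert (H : forall n, INR n * (a - b) <= 1 /\ INR n * (b - a) <= 1).
  { intros n. destruct (pullback_vectors n 0 a b)
      as (A & C & A' & C' & x & y & H1 & H2 & H3 & H4 & H5 & _ & H7 & _ & H9);
      [ now apply cell_0 | lia | assumption | ].
    unfold vcoord in *. simpl in *. rewrite s_1, s_0 in *. pose proof (pos_INR n) as Hn.
    assert (0 <= INR n * x) by (apply Rmult_le_pos; lra).
    assert (0 <= INR n * y) by (apply Rmult_le_pos; lra).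
    assert (HC : 1 <= C) by lra. assert (HC' : 1 <= C') by lra.
    assert (E : (a - b) * (C * C') = x - y) by (rewrite <- H5, H3, H4; ring).
    assert (C <= C * C') by nra. assert (C' <= C * C') by nra.
    split; apply Rmult_le_reg_r with (C * C'); try lra.
    - rewrite Rmult_assoc, E. nra.
    - replace (INR n * (b - a) * (C * C')) with (- (INR n * ((a - b) * (C * C')))) by ring.
      rewrite E. nra. }
  assert (Hle : forall t, (forall n, INR n * t <= 1) -> t <= 0).
  { intros t Ht. apply Rnot_lt_le. intros Hpos. destruct (INR_unbounded (/ t)) as [n Hn].
    specialize (Ht n). apply Rmult_lt_compat_r with (r := t) in Hn; [ | exact Hpos ].
    rewrite Rinv_l in Hn; lra. }
  pose proof (Hle (a - b) (fun n => proj1 (H n))). pose proof (Hle (b - a) (fun n => proj2 (H n))).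
  lra.
Qed.

Lemma cell_reaches_lam (i : nat) (q : R * R) : cell i (fst q) -> l <= fst (piter i q).
Proof.
  revert q. induction i as [|i IH]; intros [a b] H; [ now apply cell_0 | ].
  rewrite piter_S, pstep_one by now apply (cell_S_digit i).
  apply IH. now apply cell_S_step.
Qed.

Lemma eventually_reduced (q : R * R) : cpair q -> exists n, reduced_pair (piter n q).
Proof.
  intros Hc.
  (* Either some iterate is split by [l] and the next step enters the region, or from the first
     iterate known to be at least [l] on the pair is unseparated, so its components coincide. *)
  destruct (classic (exists j, l <= fst (piter j q) /\ snd (piter j q) < l)) as [[j [H1 H2]]|H].
  - exists (S j). pose proof (cpair_piter j q Hc) as Hj.
    pose proof (conj_pair_ne_mul 1 _ _ Hj).
    rewrite piter_Sout. apply straddle_step_reduced; [ exact Hj | lra | exact H2 ].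
  - exfalso. destruct (cell_exists_strong _ (pstep_fst_ge q)) as (i & _ & HI).
    apply cell_reaches_lam in HI. rewrite <- piter_S in HI.
    pose proof (cpair_piter (S i) q Hc) as [Hne _].
    apply Hne, unseparated_eq; [ exact HI | ].
    rewrite <- surjective_pairing. intros n. rewrite <- piter_add. split.
    + apply (conj_pair_ne_mul _ _ (fst (piter (n + S i) q))), conj_pair_sym, cpair_piter, Hc.
    + intros Hn. apply Rnot_lt_le. intros Hn'. apply H. now exists (n + S i)%nat.
Qed.

(** * Shifted expansions and the exceptional period *)

Lemma cf_alpha_add (a : R) (m n : nat) :
  cf_alpha l a (m + n) = cf_alpha l (cf_alpha l a n) m.
Proof. induction m as [|m IH]; [ reflexivity | ]. simpl. now rewrite IH. Qed.

Lemma cf_r_add (a : R) (m n : nat) : cf_r l a (m + n) = cf_r l (cf_alpha l a n) m.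
Proof. unfold cf_r. now rewrite cf_alpha_add. Qed.

(* The expansion of [a] with exceptional period drags the cusp [l] along, so that
   [a] and [l] are never separated. *)
Lemma exceptional_orbit (a : R) (n : nat) : exceptional_period p (cf_r l a) ->
  exists i, cell i (fst (piter n (a, l))) /\ snd (piter n (a, l)) * s (i + 1) = s (i + 2).
Proof.
  intros HE. pose proof lam_ge1 as Hl. induction n as [|n (i & HI & Hy)].
  - exists 0%nat. split.
    + apply cell_0. specialize (HE 0%nat). rewrite Nat.Div0.mod_0_l in HE. simpl in HE.
      pose proof (digit_bounds a) as H. unfold cf_r in HE. simpl in HE. rewrite HE in H.
      simpl. lra.
    + simpl. rewrite s_2, s_1. ring.
  - rewrite piter_Sout. destruct i as [|i].
    + simpl in Hy. rewrite s_2, s_1, Rmult_1_r in Hy.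
      apply cell_0 in HI. apply digit_ge2 in HI.
      pose proof (HE n) as Hn. unfold cf_r in Hn. rewrite <- (piter_fst n a l) in Hn.
      destruct (Nat.eqb_spec (n mod (p - 2)) 0) as [Hm|Hm]; [ | rewrite Hn in HI; lra ].
      destruct (cell_exists_strong _ (pstep_fst_ge (piter n (a, l)))) as (i & Hi & HI').
      exists i. split; [ exact HI' | ].
      apply cell_leading_ones in HI'. destruct HI' as [_ HI'].
      rewrite <- piter_Sout, piter_fst, <- cf_r_add, HE in HI'.
      destruct (Nat.eqb_spec ((i + S n) mod (p - 2)) 0) as [Hm'|]; [ | congruence ].
      (* Positions [n] and [n + i + 1] both carry the digit 2, so [p - 2] divides [i + 1], and
         [i + 1 <= p - 2]. *)
      assert (Ei : (i + 3)%nat = p).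
      { apply Nat.Div0.mod_divides in Hm. destruct Hm as [c Hc].
        apply Nat.Div0.mod_divides in Hm'. destruct Hm' as [c' Hc'].
        assert (c < c')%nat by nia. assert ((p - 2) * (c + 1) <= (p - 2) * c')%nat by nia. lia. }
      (* The digit 2 sends [l] to [1 / l], the lower end of cell [p - 3]. *)
      rewrite (s_pred_p (i + 2)), (s_pred2_p (i + 1)) by lia.
      unfold pstep. rewrite Hn, Hy. simpl. field. lra.
    + exists i. destruct (piter n (a, l)) as [x y]. cbn [fst snd] in HI, Hy.
      rewrite pstep_one by now apply (cell_S_digit i). split; [ now apply cell_S_step | ].
      destruct HI as (Hi & _). replace (S i + 1)%nat with (S (S i)) in * by lia.
      replace (S i + 2)%nat with (S (S (S i))) in * by lia.
      rewrite (s_rec (S i)) in Hy. simpl.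
      replace (i + 1)%nat with (S i) by lia. replace (i + 2)%nat with (S (S i)) by lia.
      pose proof (s_pos (S i) ltac:(lia)).
      assert (Hyl : l - y <> 0) by (intros E; nra).
      apply Rmult_eq_reg_l with (l - y); [ | exact Hyl ].
      rewrite <- Rmult_assoc, Rinv_r by exact Hyl. lra.
Qed.

Lemma exceptional_eq (a : R) : exceptional_period p (cf_r l a) -> a = l.
Proof.
  intros HE. pose proof lam_ge1 as Hl. apply unseparated_eq.
  - destruct (exceptional_orbit a 0 HE) as ([|i] & HI & Hy); [ now apply cell_0 in HI | ].
    specialize (HE 0%nat). rewrite Nat.Div0.mod_0_l in HE.
    apply cell_S_digit in HI. unfold cf_r in HE. simpl in *. congruence.
  - intros n. destruct (exceptional_orbit a n HE) as ([|i] & HI & Hy).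
    + simpl in Hy. rewrite s_2, s_1, Rmult_1_r in Hy. rewrite Hy.
      apply cell_0 in HI. apply digit_ge2 in HI. split; [ nra | lra ].
    + pose proof (cell_S_digit _ _ HI) as Hd. destruct HI as (Hi & _ & HI).
      apply below_lam in HI; [ | lia ]. split; [ | lra ]. rewrite Hd. intros E. rewrite E in Hy.
      replace (S i + 1)%nat with (S (S i)) in * by lia.
      replace (S i + 2)%nat with (S (S (S i))) in * by lia.
      rewrite (s_rec (S i)) in Hy. pose proof (s_pos (S i) ltac:(lia)). lra.
Qed.

(** * The theorem in terms of reduced pairs *)

Lemma reduced_at_Gp_reduced (k : nat) (a b : R) : conj_pair a b ->
  reduced_at k (a, b) -> Gp_reduced p a /\ leading_ones l a k.
Proof.
  intros Hc HQ. split; [ split | now apply cell_leading_ones, (reduced_at_cell _ _ HQ) ].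
  - destruct (reduced_periodic (a, b)) as (n & Hn & E); [ exact Hc | now exists k | ].
    exists n. split; [ exact Hn | ]. intros j.
    now rewrite cf_r_add, <- (piter_fst n a b), E.
  - intros HE. apply exceptional_eq in HE. apply (conj_pair_ne_mul 1 _ _ Hc). lra.
Qed.

(** Equal digits make the translation in [pstep_eq] zero, so the return of the pair can be undone
    one step at a time. *)
Lemma piter_periodic_back (N n : nat) (q : R * R) :
  (forall j, cf_digit l (fst (piter (n + j) q)) = cf_digit l (fst (piter j q))) ->
  piter n (piter N q) = piter N q -> piter n q = q.
Proof.
  intros Hd. induction N as [|N IH]; intros E; [ exact E | ].
  apply IH. rewrite (piter_Sout N), <- piter_S, piter_Sout in E.
  apply pstep_eq in E. simpl in E. rewrite <- piter_add, Hd, Z.sub_diag in E.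
  rewrite <- piter_add, E. rewrite !Rmult_0_l, !Rplus_0_r. symmetry. apply surjective_pairing.
Qed.

Lemma purely_periodic_reduced_at (k : nat) (a b : R) : conj_pair a b ->
  purely_periodic (cf_r l a) -> leading_ones l a k -> reduced_at k (a, b).
Proof.
  intros Hc (m & Hm & Hr) Hk.
  destruct (eventually_reduced (a, b) Hc) as [N HN].
  destruct (reduced_periodic _ (cpair_piter N (a, b) Hc) HN) as (n & Hn & E).
  assert (Hr' : forall c j, cf_r l a (c * m + j) = cf_r l a j).
  { induction c as [|c IH]; intros j; [ reflexivity | ].
    rewrite <- (IH j), <- (Hr (c * m + j)%nat). f_equal. lia. }
  (* [n * m] is a common multiple of the period of the late pair and the period of the digits. *)
  assert (EL : piter (n * m) (a, b) = (a, b)).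
  { apply (piter_periodic_back N).
    - intros j. rewrite !piter_fst. apply Hr'.
    - rewrite Nat.mul_comm. now apply piter_mul. }
  assert (HR : reduced_pair (a, b)).
  (* A multiple of the period beyond [N] shows that the initial pair is itself an iterate of a
     reduced one. *)
  { assert (N <= N * (n * m))%nat
      by (assert (1 <= n * m)%nat by nia; rewrite <- (Nat.mul_1_r N) at 1;
          now apply Nat.mul_le_mono_l).
    rewrite <- (piter_mul _ N _ EL).
    replace (N * (n * m))%nat with (N * (n * m) - N + N)%nat by lia.
    rewrite piter_add. apply reduced_piter; [ now apply cpair_piter | exact HN ]. }
  destruct HR as [k' HQ].
  pose proof (cell_leading_ones _ _ (reduced_at_cell _ _ HQ)) as Hk'. simpl in Hk'.
  now rewrite (leading_ones_unique _ _ _ Hk Hk').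
Qed.

(** * The points [U^n (0)] *)

Lemma act_mpow_U (n : nat) :
  act (mpow (Umat l) (S n)) (Some 0) =
    if Req_EM_T (s n) 0 then None else Some (s (S n) / s n).
Proof.
  rewrite mpow_U. simpl.
  destruct (Req_EM_T (s (S n) * 0 + - s n) 0) as [E|E], (Req_EM_T (s n) 0) as [E'|E'];
    try (exfalso; lra); [ reflexivity | ].
  f_equal. field. exact E'.
Qed.

Lemma s_add_p (n : nat) : s (n + p) = - s n.
Proof.
  unfold s. rewrite plus_INR, Rmult_plus_distr_r, angle_mul, neg_sin. unfold Rdiv. ring.
Qed.

Lemma act_mpow_U_add_p (n : nat) :
  act (mpow (Umat l) (S n + p)) (Some 0) = act (mpow (Umat l) (S n)) (Some 0).
Proof.
  change (S n + p)%nat with (S (n + p)). rewrite !act_mpow_U.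
  change (S (n + p)) with (S n + p)%nat. rewrite !s_add_p.
  destruct (Req_EM_T (- s n) 0), (Req_EM_T (s n) 0); try (exfalso; lra); [ reflexivity | ].
  f_equal. field. assumption.
Qed.

(** [U^p = -I] acts trivially, so the chain is periodic in [k]; minimality of [k] therefore excludes
    [k >= p]. *)
Lemma chain_add_p (k : nat) (a b : R) : chain l a b (k + p) <-> chain l a b k.
Proof.
  unfold chain. replace (k + p + 2)%nat with (S (S k) + p)%nat by lia.
  replace (k + p + 1)%nat with (S k + p)%nat by lia. rewrite !act_mpow_U_add_p.
  replace (k + 2)%nat with (S (S k)) by lia. now replace (k + 1)%nat with (S k) by lia.
Qed.

Lemma Rlt_div_iff (x y c : R) : 0 < c -> x < y / c <-> x * c < y.
Proof.
  intros Hc. assert (E : y / c * c = y) by (field; lra). split; intros H; nra.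
Qed.

Lemma Rdiv_lt_iff (x y c : R) : 0 < c -> y / c < x <-> y < x * c.
Proof.
  intros Hc. assert (E : y / c * c = y) by (field; lra). split; intros H; nra.
Qed.

Lemma chain_reduced_at (k : nat) (a b : R) :
  (k + 3 <= p)%nat -> chain l a b k <-> reduced_at k (a, b).
Proof.
  intros Hk. unfold chain, reduced_at.
  replace (k + 2)%nat with (S (S k)) by lia. replace (k + 1)%nat with (S k) by lia.
  rewrite !act_mpow_U. pose proof (s_pos (S k) ltac:(lia)) as H1.
  destruct (Req_EM_T (s (S k)) 0); [ lra | ]. simpl.
  rewrite Rlt_div_iff, Rdiv_lt_iff by assumption.
  destruct (Req_EM_T (s k) 0) as [E|E].
  - rewrite E, Rmult_0_r. simpl. tauto.
  - pose proof (s_nonneg k ltac:(lia)). simpl. rewrite Rlt_div_iff by lra. tauto.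
Qed.

(** For [k = p - 2] the bound [U^p(0) = 0] contradicts [0 < alpha']; for [k = p - 1] the point
    [U^(p+1)(0)] is infinity and cannot lie below [alpha]. *)
Lemma chain_bound (k : nat) (a b : R) : (k < p)%nat -> chain l a b k -> (k + 3 <= p)%nat.
Proof.
  intros Hk (H0 & H1 & H2 & _).
  assert (C : (k + 3 <= p \/ S (S k) = p \/ S k = p)%nat) by lia.
  destruct C as [C|[C|C]]; [ exact C | exfalso .. ];
    replace (k + 2)%nat with (S (S k)) in * by lia; rewrite act_mpow_U in *.
  - rewrite C, s_p, (s_pred_p (S k)) in * by lia.
    destruct (Req_EM_T 1 0); simpl in *; lra.
  - rewrite C, s_p in *. destruct (Req_EM_T 0 0); [ exact H2 | lra ].
Qed.

Lemma minimal_chain_reduced_at (k : nat) (a b : R) :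
  chain l a b k /\ (forall j, (j < k)%nat -> ~ chain l a b j) <-> reduced_at k (a, b).
Proof.
  split.
  - intros [H Hm]. destruct (Nat.lt_ge_cases k p) as [Hk|Hk].
    + apply chain_reduced_at; [ now apply (chain_bound k a b) | exact H ].
    + exfalso. apply (Hm (k - p)%nat); [ lia | ].
      apply chain_add_p. now replace (k - p + p)%nat with k by lia.
  - intros HQ. assert (Hk : (k + 3 <= p)%nat) by apply HQ. split; [ now apply chain_reduced_at | ].
    (* A chain with a smaller index [j] would give [alpha] exactly [j] leading ones as well. *)
    intros j Hj HC. apply chain_reduced_at in HC; [ | lia ].
    apply reduced_at_cell, cell_leading_ones in HC. apply reduced_at_cell, cell_leading_ones in HQ.
    pose proof (leading_ones_unique _ _ _ HC HQ). lia.
Qed.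

End Hecke.

Theorem theorem4p3 (p : nat) (alpha alpha' : R) (k : nat) :
  (3 <= p)%nat ->
  hyperbolic_fixed_point (lam p) alpha ->
  hecke_conjugate (lam p) alpha alpha' ->
  ((Gp_reduced p alpha /\ leading_ones (lam p) alpha k) <->
   (chain (lam p) alpha alpha' k /\
    forall j : nat, (j < k)%nat -> ~ chain (lam p) alpha alpha' j)).
Proof.
  intros Hp _ Hc. apply hecke_conjugate_conj_pair in Hc.
  rewrite (minimal_chain_reduced_at p Hp). split.
  - intros [[HP _] Hk]. now apply purely_periodic_reduced_at.
  - now apply reduced_at_Gp_reduced.
Qed.
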